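(* Let $R$ be a Noetherian commutative ring with non-zero identity. Let $M$ be a finitely generated $R$-module and $N$ a weakly Laskerian $R$-module. If $\mathfrak{m}$ is a maximal ideal of $R$, then $\mathrm{Supp}(H^i_{\mathfrak{m}}(M,N))$ and $\mathrm{Ass}(R^iD_{\mathfrak{m}}(M,N))$ are finite sets for all $i\geq 0$.
   Context: For an ideal $I$ of $R$ and $R$-modules $M,N$: the $i$-th generalized local cohomology module is $H^i_I(M,N)=\varinjlim_n \mathrm{Ext}^i_R(M/I^nM,N)$; the generalized ideal transform is $D_I(M,N)=\varinjlim_n \mathrm{Hom}_R(I^nM,N)$ (transition maps being restrictions); $R^iD_I(M,-)$ denotes the $i$-th right derived functor of $D_I(M,-)$ (so $R^0D_I(M,-)=D_I(M,-)$), and it is isomorphic to $\varinjlim_n \mathrm{Ext}^i_R(I^nM,-)$. An $R$-module is weakly Laskerian if every quotient module of it has only finitely many associated primes. *)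

(* Defs.v *)
From HB Require Import structures.
From mathcomp Require Import all_boot all_algebra.
From mathcomp Require Import generic_quotient ring_quotient.
From mathcomp Require Import ring.
From mathcomp Require Import boolp classical_sets functions cardinality.

Set Implicit Arguments.
Unset Strict Implicit.
Unset Printing Implicit Defensive.

Import GRing.Theory.
Local Open Scope ring_scope.
Local Open Scope quotient_scope.

Definition mkLinear (R : pzRingType) (U V : lmodType R) (f : U -> V)
    (fL : linear f) : {linear U -> V} :=
  HB.pack_for {linear U -> V} f (GRing.isLinear.Build R U V *:%R f fL).

Lemma linear_ext (R : pzRingType) (U V : lmodType R) (f g : {linear U -> V}) :
  f =1 g -> f = g.
Proof.
case: f g => f [[fN] [fS]] [g [[gN] [gS]]] /= /funext fg.
by subst g; rewrite (Prop_irrelevance fN gN) (Prop_irrelevance fS gS).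
Qed.

Section Submodules.
Variable R : comNzRingType.
Implicit Types U V W : lmodType R.

Section MkSubmod.
Variables (V : lmodType R) (P : V -> Prop) (P0 : P 0).
Hypothesis PL : forall a x y, P x -> P y -> P (a *: x + y).

Let mem (x : V) : bool := `[< P x >].

Fact mkSubmod_subproof : subsemimod_closed mem.
Proof.
apply: GRing.submod_closed_semi; split=> [|a x y]; rewrite !unfold_in.
  exact/asboolP.
by move=> /asboolP Px /asboolP Py; exact/asboolP/PL.
Qed.

Definition mkSubmod : submodClosed V :=
  HB.pack_for (submodClosed V) mem
    (GRing.isSubmodClosed.Build R V mem mkSubmod_subproof).

Lemma mkSubmodP x : reflect (P x) (x \in mkSubmod).
Proof. by rewrite unfold_in; exact: asboolP. Qed.

End MkSubmod.
Arguments mkSubmodP {V P P0 PL x}.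

Definition submod_full V : submodClosed V.
Proof. by refine (@mkSubmod V (fun=> True) _ _). Defined.

Definition submod_span V (A : set V) : submodClosed V.
Proof.
refine (@mkSubmod V
  (fun x => forall S : submodClosed V, (forall a, A a -> a \in S) -> x \in S) _ _).
  by move=> S _; exact: rpred0.
by move=> a x y Sx Sy S AS; rewrite rpredD ?rpredZ ?Sx ?Sy.
Defined.

Lemma submod_spanP V (A : set V) x :
  reflect (forall S : submodClosed V, (forall a, A a -> a \in S) -> x \in S)
    (x \in submod_span A).
Proof. exact: mkSubmodP. Qed.

Definition submod_ker V W (f : {linear V -> W}) : submodClosed V.
Proof.
refine (@mkSubmod V (fun x => f x = 0) (linear0 f) _).
by move=> a x y fx fy; rewrite linearP fx fy scaler0 addr0.
Defined.

Definition submod_preim V W (f : {linear V -> W}) (S : submodClosed W) : submodClosed V.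
Proof.
refine (@mkSubmod V (fun x => f x \in S) _ _); first by rewrite linear0 rpred0.
by move=> a x y fx fy; rewrite linearP rpredD ?rpredZ.
Defined.

Definition submod_im V W (f : {linear V -> W}) : submodClosed W.
Proof.
refine (@mkSubmod W (fun y => exists x, f x = y) _ _); first by exists 0; exact: linear0.
by move=> a _ _ [x <-] [y <-]; exists (a *: x + y); rewrite linearP.
Defined.

Definition submod V (S : submodClosed V) : Type := {x : V | x \in S}.

Section Sub.
Variables (V : lmodType R) (S : submodClosed V).
HB.instance Definition _ := [isSub of submod S for @sval _ _].
HB.instance Definition _ := [Choice of submod S by <:].
HB.instance Definition _ := [SubChoice_isSubLmodule of submod S by <:].
End Sub.

Definition submod_incl V (S : submodClosed V) : {linear submod S -> V} := \val.

Definition submod_map V W (f : {linear V -> W}) (S : submodClosed V)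
    (T : submodClosed W) (fST : {in S, forall x, f x \in T}) :
  {linear submod S -> submod T}.
Proof.
refine (@mkLinear R (submod S) (submod T)
  (fun x => exist _ (f (val x)) (fST _ (valP x))) _).
by move=> a x y; apply: val_inj; rewrite /= linearP.
Defined.

Definition submod_zmod V (S : submodClosed V) : zmodClosed V :=
  HB.pack_for (zmodClosed V) (S : {pred V})
    (GRing.isZmodClosed.Build V (S : {pred V})
       (GRing.subsemimod_closedB (GRing.subsemimodClosedP S))).

Definition quotmod V (S : submodClosed V) : Type := Quotient.quot (submod_zmod S).

Section Quo.
Variables (V : lmodType R) (S : submodClosed V).
HB.instance Definition _ := GRing.Zmodule.on (quotmod S).
HB.instance Definition _ := EqQuotient.on (quotmod S).

Definition cls (x : V) : quotmod S := \pi x.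

Lemma clsK u : cls (repr u) = u. Proof. exact: reprK. Qed.

Lemma clsE (x y : V) : (cls x == cls y) = (x - y \in S).
Proof. exact: (esym (Quotient.idealrBE (submod_zmod S) x y)). Qed.

Lemma clsD x y : cls x + cls y = cls (x + y).
Proof. exact: (esym (Quotient.pi_add (submod_zmod S) x y)). Qed.

Definition quotmod_scale (a : R) (u : quotmod S) : quotmod S := cls (a *: repr u).

Lemma clsZ a x : quotmod_scale a (cls x) = cls (a *: x).
Proof. by apply/eqP; rewrite clsE -scalerBr rpredZ // -clsE clsK. Qed.

Fact quotmod_scaleA a b u : quotmod_scale a (quotmod_scale b u) = quotmod_scale (a * b) u.
Proof. by rewrite -[u]clsK !clsZ scalerA. Qed.
Fact quotmod_scale1 : left_id 1 quotmod_scale.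
Proof. by move=> u; rewrite -[u]clsK clsZ scale1r. Qed.
Fact quotmod_scaleDr : right_distributive quotmod_scale +%R.
Proof.
move=> a u v; rewrite -[u]clsK -[v]clsK clsD !clsZ clsD.
by rewrite scalerDr.
Qed.
Fact quotmod_scaleDl u : {morph quotmod_scale^~ u : a b / a + b}.
Proof. by move=> a b; rewrite -[u]clsK !clsZ clsD scalerDl. Qed.

HB.instance Definition _ := GRing.Zmodule_isLmodule.Build R (quotmod S)
  quotmod_scaleA quotmod_scale1 quotmod_scaleDr quotmod_scaleDl.

Fact cls_linear : linear cls.
Proof. by move=> a x y; rewrite -clsD -clsZ. Qed.

Definition quotmod_proj : {linear V -> quotmod S} := mkLinear cls_linear.

Lemma quotmod_projK (u : quotmod S) : quotmod_proj (repr u) = u. Proof. exact: reprK. Qed.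

Lemma quotmod_proj_eq0 x : (quotmod_proj x == 0) = (x \in S).
Proof. by rewrite -(linear0 quotmod_proj) clsE subr0. Qed.

End Quo.

Definition quotmod_map V W (f : {linear V -> W}) (S : submodClosed V)
    (T : submodClosed W) (fST : {in S, forall x, f x \in T}) :
  {linear quotmod S -> quotmod T}.
Proof.
refine (@mkLinear R (quotmod S) (quotmod T) (fun u => quotmod_proj T (f (repr u))) _) => a u v.
rewrite -(linearP (quotmod_proj T)) -(linearP f); apply/eqP; rewrite clsE -(linearB f); apply: fST.
by rewrite -clsE clsK cls_linear !clsK.
Defined.

Lemma quotmod_mapE V W (f : {linear V -> W}) S T fST x :
  @quotmod_map V W f S T fST (quotmod_proj S x) = quotmod_proj T (f x).
Proof. by apply/eqP; rewrite clsE -(linearB f); apply: fST; rewrite -clsE clsK. Qed.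

End Submodules.

Section Hom.
Variables (R : comNzRingType) (U V : lmodType R).

Definition Hom : Type := {linear U -> V}.
HB.instance Definition _ := gen_eqMixin Hom.
HB.instance Definition _ := gen_choiceMixin Hom.

Let zero : Hom := \0.
Let add (f g : Hom) : Hom := f \+ g.
Let opp (f : Hom) : Hom := \- f.
Let scale (a : R) (f : Hom) : Hom := a \*: f.

Let addA : associative add.
Proof. by move=> f g h; apply: linear_ext => x /=; rewrite addrA. Qed.
Let addC : commutative add.
Proof. by move=> f g; apply: linear_ext => x /=; rewrite addrC. Qed.
Let add0 : left_id zero add.
Proof. by move=> f; apply: linear_ext => x /=; rewrite add0r. Qed.
Let addN : left_inverse zero opp add.
Proof. by move=> f; apply: linear_ext => x /=; rewrite addNr. Qed.
HB.instance Definition _ := GRing.isZmodule.Build Hom addA addC add0 addN.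

Let scaleA a b f : scale a (scale b f) = scale (a * b) f.
Proof. by apply: linear_ext => x /=; rewrite scalerA. Qed.
Let scale1 : left_id 1 scale.
Proof. by move=> f; apply: linear_ext => x /=; rewrite scale1r. Qed.
Let scaleDr : right_distributive scale +%R.
Proof. by move=> a f g; apply: linear_ext => x /=; rewrite scalerDr. Qed.
Let scaleDl f : {morph scale^~ f : a b / a + b}.
Proof. by move=> a b; apply: linear_ext => x /=; rewrite scalerDl. Qed.
HB.instance Definition _ :=
  GRing.Zmodule_isLmodule.Build R Hom scaleA scale1 scaleDr scaleDl.

End Hom.

Definition postcomp (R : comNzRingType) (A U V : lmodType R)
    (f : {linear U -> V}) : {linear Hom A U -> Hom A V}.
Proof.
refine (@mkLinear R (Hom A U) (Hom A V) (fun h : {linear A -> U} => f \o h) _).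
by move=> a g h; apply: linear_ext => x /=; rewrite linearP.
Defined.

Definition precomp (R : comNzRingType) (A B V : lmodType R)
    (g : {linear A -> B}) : {linear Hom B V -> Hom A V}.
Proof.
by refine (@mkLinear R (Hom B V) (Hom A V) (fun h : {linear B -> V} => h \o g) _) => a h k;
  apply: linear_ext.
Defined.

(* The direct limit of a sequence V_0 -> V_1 -> V_2 -> ...: the quotient of the
   direct sum of the V_n by the submodule spanned by the elements
   iota_n x - iota_{n+1} (v_n x). *)

Section DirectLimit.
Variable R : comNzRingType.

Record direct_system := DirectSystem {
  dobj :> nat -> lmodType R;
  dmap : forall n, {linear dobj n -> dobj n.+1} }.

Definition direct_prod (V : nat -> lmodType R) : Type := forall n, V n.

Section DirectProduct.
Variable V : nat -> lmodType R.
HB.instance Definition _ := gen_eqMixin (direct_prod V).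
HB.instance Definition _ := gen_choiceMixin (direct_prod V).

Let zero : direct_prod V := fun=> 0.
Let add (x y : direct_prod V) : direct_prod V := fun n => x n + y n.
Let opp (x : direct_prod V) : direct_prod V := fun n => - x n.
Let scale (a : R) (x : direct_prod V) : direct_prod V := fun n => a *: x n.

Let addA : associative add.
Proof. by move=> x y z; apply: functional_extensionality_dep => n; exact: addrA. Qed.
Let addC : commutative add.
Proof. by move=> x y; apply: functional_extensionality_dep => n; exact: addrC. Qed.
Let add0 : left_id zero add.
Proof. by move=> x; apply: functional_extensionality_dep => n; exact: add0r. Qed.
Let addN : left_inverse zero opp add.
Proof. by move=> x; apply: functional_extensionality_dep => n; exact: addNr. Qed.
HB.instance Definition _ := GRing.isZmodule.Build (direct_prod V) addA addC add0 addN.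

Let scaleA a b x : scale a (scale b x) = scale (a * b) x.
Proof. by apply: functional_extensionality_dep => n; exact: scalerA. Qed.
Let scale1 : left_id 1 scale.
Proof. by move=> x; apply: functional_extensionality_dep => n; exact: scale1r. Qed.
Let scaleDr : right_distributive scale +%R.
Proof. by move=> a x y; apply: functional_extensionality_dep => n; exact: scalerDr. Qed.
Let scaleDl x : {morph scale^~ x : a b / a + b}.
Proof. by move=> a b; apply: functional_extensionality_dep => n; exact: scalerDl. Qed.
HB.instance Definition _ :=
  GRing.Zmodule_isLmodule.Build R (direct_prod V) scaleA scale1 scaleDr scaleDl.
End DirectProduct.

Definition direct_sum (V : nat -> lmodType R) : submodClosed (direct_prod V).
Proof.
refine (@mkSubmod R (direct_prod V)
  (fun x => exists k, forall n, (k <= n)%N -> x n = 0) _ _); first by exists 0%N.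
move=> a x y [k xk] [l yl]; exists (maxn k l) => n; rewrite geq_max => /andP[kn ln].
by rewrite [LHS](_ : _ = a *: x n + y n) // xk // yl // scaler0 addr0.
Defined.

Definition single (V : nat -> lmodType R) n (x : V n) : direct_prod V :=
  @eqtype.dfwith nat V (fun=> 0) n x.
Arguments single V [n] x.

Definition direct_limit_rel (V : direct_system) : submodClosed (submod (direct_sum V)) :=
  submod_span [set z | exists n (x : V n), val z = single V x - single V (dmap V n x)]%classic.

Definition direct_limit (V : direct_system) : lmodType R := quotmod (direct_limit_rel V).

Section Map.
Variables (V W : direct_system) (f : forall n, {linear V n -> W n}).
Hypothesis fE : forall n x, f n.+1 (dmap V n x) = dmap W n (f n x).

Definition direct_prod_map : {linear direct_prod V -> direct_prod W}.
Proof.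
refine (@mkLinear R (direct_prod V) (direct_prod W) (fun x n => f n (x n)) _) => a x y.
by apply: functional_extensionality_dep => n; exact: linearP.
Defined.

Lemma direct_prod_map_single n (x : V n) : direct_prod_map (single V x) = single W (f n x).
Proof.
apply: functional_extensionality_dep => k; rewrite /= /single.
have [<-|nk] := eqVneq n k; first by rewrite !eqtype.dfwith_in.
by rewrite !eqtype.dfwith_out // linear0.
Qed.

Fact direct_sum_map_subproof : {in direct_sum V, forall x, direct_prod_map x \in direct_sum W}.
Proof.
by move=> x /mkSubmodP[k xk]; apply/mkSubmodP; exists k => n /xk /= ->; exact: linear0.
Qed.

Definition direct_sum_map : {linear submod (direct_sum V) -> submod (direct_sum W)} :=
  submod_map direct_sum_map_subproof.

Fact direct_limit_map_subproof : {in direct_limit_rel V, forall z, direct_sum_map z \in direct_limit_rel W}.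
Proof.
move=> z /mkSubmodP zV.
suff: z \in submod_preim direct_sum_map (direct_limit_rel W) by move/mkSubmodP.
apply: zV => {}z [n [x zE]]; apply/mkSubmodP/mkSubmodP => S; apply.
by exists n, (f n x); rewrite /= zE -[LHS]/(direct_prod_map _) linearB !direct_prod_map_single fE.
Qed.

Definition direct_limit_map : {linear direct_limit V -> direct_limit W} := quotmod_map direct_limit_map_subproof.

Lemma direct_limit_mapE z : direct_limit_map (quotmod_proj _ z) = quotmod_proj _ (direct_sum_map z).
Proof. exact: quotmod_mapE. Qed.

End Map.
End DirectLimit.

Section Derived.
Variable R : comNzRingType.

Record cochain_complex := Complex {
  cobj :> nat -> lmodType R;
  cdiff : forall i, {linear cobj i -> cobj i.+1};
  cdiff2 : forall i x, cdiff i.+1 (cdiff i x) = 0 }.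

Definition cocycles (C : cochain_complex) i : submodClosed (C i) := submod_ker (cdiff C i).

Definition coboundaries (C : cochain_complex) i : submodClosed (C i) :=
  match i with
  | 0 => submod_im (\0 : {linear C 0%N -> C 0%N})
  | i.+1 => submod_im (cdiff C i)
  end.

Definition cohomology (C : cochain_complex) i : lmodType R :=
  quotmod (submod_preim (submod_incl (cocycles C i)) (coboundaries C i)).

Section CohomologyMap.
Variables (C D : cochain_complex) (f : forall i, {linear C i -> D i}).
Hypothesis fE : forall i x, f i.+1 (cdiff C i x) = cdiff D i (f i x).

Fact cocycles_map_subproof i : {in cocycles C i, forall x, f i x \in cocycles D i}.
Proof.
by move=> x /mkSubmodP xC; apply/mkSubmodP; rewrite -fE xC linear0.
Qed.

Definition cocycles_map i : {linear submod (cocycles C i) -> submod (cocycles D i)} :=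
  submod_map (@cocycles_map_subproof i).

Fact cohomology_map_subproof i :
  {in submod_preim (submod_incl (cocycles C i)) (coboundaries C i), forall x,
    cocycles_map i x \in submod_preim (submod_incl (cocycles D i)) (coboundaries D i)}.
Proof.
move=> x /mkSubmodP xC; apply/mkSubmodP; move: xC; rewrite /submod_incl /=.
case: i x => [|i] x /mkSubmodP[y yx]; apply/mkSubmodP; rewrite -yx.
  by exists 0; rewrite /= linear0.
by exists (f i y); rewrite fE.
Qed.

Definition cohomology_map i : {linear cohomology C i -> cohomology D i} :=
  quotmod_map (@cohomology_map_subproof i).

End CohomologyMap.

Definition injective_module (E : lmodType R) : Prop :=
  forall (A B : lmodType R) (f : {linear A -> B}) (g : {linear A -> E}),
    injective f -> exists h : {linear B -> E}, forall x, h (f x) = g x.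

Record injective_resolution (N : lmodType R) := InjectiveResolution {
  robj :> nat -> lmodType R;
  rdiff : forall i, {linear robj i -> robj i.+1};
  raug : {linear N -> robj 0};
  robj_inj : forall i, injective_module (robj i);
  raug_inj : injective raug;
  raug_exact : forall x, rdiff 0 x = 0 <-> exists y, raug y = x;
  rdiff_exact : forall i x, rdiff i.+1 x = 0 <-> exists y, rdiff i y = x }.

Record additive_functor := AdditiveFunctor {
  fobj :> lmodType R -> lmodType R;
  fmap : forall U V : lmodType R, {linear U -> V} -> {linear fobj U -> fobj V};
  fmap_id : forall (U : lmodType R) x, fmap (idfun : {linear U -> U}) x = x;
  fmap_comp : forall (U V W : lmodType R) (f : {linear V -> W})
    (g : {linear U -> V}) x, fmap (f \o g) x = fmap f (fmap g x);
  fmap_add : forall (U V : lmodType R) (f g : {linear U -> V}) x,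
    fmap (f \+ g) x = fmap f x + fmap g x }.

Arguments fmap _ [U V] f.
Arguments fmap_add _ [U V] f g x.
Arguments fmap_comp _ [U V W] f g x.

Lemma fmap0 (F : additive_functor) (U V : lmodType R) x :
  fmap F (\0 : {linear U -> V}) x = 0.
Proof.
have := fmap_add F (\0 : {linear U -> V}) \0 x.
rewrite (_ : _ \+ _ = \0 :> {linear _ -> _}); last by apply: linear_ext => y; exact: addr0.
by move/eqP; rewrite eq_sym -subr_eq0 addrK => /eqP.
Qed.

Section RightDerived.
Variables (N : lmodType R) (E : injective_resolution N).

(* F(E^0) -> F(E^1) -> ... *)
Definition apply_complex (F : additive_functor) : cochain_complex.
Proof.
refine (@Complex (fun i => F (E i)) (fun i => fmap F (rdiff E i)) _) => i x.
rewrite -fmap_comp (_ : _ \o _ = \0 :> {linear _ -> _}) ?fmap0 //.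
by apply: linear_ext => y; apply/rdiff_exact; exists y.
Defined.

(* (R^i F)(N), computed from the injective resolution E of N; it does not depend
   on E up to isomorphism. *)
Definition right_derived (F : additive_functor) i : lmodType R :=
  cohomology (apply_complex F) i.

Variables (F G : additive_functor) (t : forall U : lmodType R, {linear F U -> G U}).
Hypothesis tE : forall (U V : lmodType R) (f : {linear U -> V}) x,
  t V (fmap F f x) = fmap G f (t U x).

Definition right_derived_map i :
    {linear right_derived F i -> right_derived G i} :=
  @cohomology_map (apply_complex F) (apply_complex G) (fun i => t (E i))
    (fun i x => tE (rdiff E i) x) i.

End RightDerived.

Definition hom_functor (A : lmodType R) : additive_functor.
Proof.
refine (@AdditiveFunctor (fun V => Hom A V) (fun U V f => postcomp A f) _ _ _).
- by move=> U x; apply: linear_ext.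
- by move=> U V W f g x; apply: linear_ext.
- by move=> U V f g x; apply: linear_ext.
Defined.

(* Ext^i(A, N) is R^i Hom(A, -) at N; it is contravariant in A. *)
Section Ext.
Variables (N : lmodType R) (E : injective_resolution N).

Definition Ext i (A : lmodType R) : lmodType R :=
  right_derived E (hom_functor A) i.

Definition Ext_map i (A B : lmodType R) (g : {linear A -> B}) :
    {linear Ext i B -> Ext i A}.
Proof.
apply: (@right_derived_map _ E (hom_functor B) (hom_functor A)
  (fun V => precomp V g)).
by move=> U V f x; apply: linear_ext.
Defined.

End Ext.
End Derived.

Section LocalCohomology.
Variables (R : comNzRingType) (I : {pred R}).

(* I S, spanned by the products of an element of I and an element of S *)
Definition ideal_mul (V : lmodType R) (S : submodClosed V) : submodClosed V :=
  submod_span [set x | exists a s, [/\ a \in I, s \in S & x = a *: s]]%classic.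

Lemma ideal_mul_sub (V : lmodType R) (S : submodClosed V) :
  {subset ideal_mul S <= S}.
Proof.
by move=> x /submod_spanP /(_ S); apply => _ [a [s [_ sS ->]]]; rewrite rpredZ.
Qed.

End LocalCohomology.

Section Powers.
Variables (R : comNzRingType) (I : {pred R}).

(* The ideal I^n, as a submodule of the regular module R^o *)
Fixpoint ideal_pow n : submodClosed R^o :=
  if n is n.+1 then ideal_mul I (ideal_pow n) else submod_full R^o.

Variable M : lmodType R.

(* I^n M *)
Definition pow_mul n : submodClosed M :=
  ideal_mul (ideal_pow n : {pred R^o}) (submod_full M).

Lemma pow_mulS n : {subset pow_mul n.+1 <= pow_mul n}.
Proof.
move=> x /submod_spanP xI; apply/submod_spanP => S IS; apply: xI => y [a [s [aI sM ->]]].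
by apply: IS; exists a, s; split=> //; exact: (ideal_mul_sub aI).
Qed.

(* I^(n+1) M -> I^n M and M / I^(n+1) M -> M / I^n M *)
Definition pow_incl n : {linear submod (pow_mul n.+1) -> submod (pow_mul n)} :=
  submod_map (f := idfun) (@pow_mulS n).

Definition pow_proj n : {linear quotmod (pow_mul n.+1) -> quotmod (pow_mul n)} :=
  quotmod_map (f := idfun) (@pow_mulS n).

(* H^i_I(M, N) = lim_n Ext^i(M / I^n M, N) *)
Definition gen_local_cohomology i (N : lmodType R) (E : injective_resolution N) :
    lmodType R :=
  direct_limit (DirectSystem (fun n => Ext_map E i (pow_proj n))).

(* D_I(M, N) = lim_n Hom(I^n M, N), a functor of N *)
Definition transform_system (N : lmodType R) : direct_system R :=
  DirectSystem (fun n => precomp N (pow_incl n)).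

Definition ideal_transform (N : lmodType R) : lmodType R :=
  direct_limit (transform_system N).

Definition ideal_transform_map (U V : lmodType R) (f : {linear U -> V}) :
    {linear ideal_transform U -> ideal_transform V}.
Proof.
refine (@direct_limit_map R (transform_system U) (transform_system V)
  (fun n => postcomp (submod (pow_mul n)) f) _).
by move=> n x; apply: linear_ext.
Defined.

Definition ideal_transform_functor : additive_functor R.
Proof.
refine (@AdditiveFunctor R ideal_transform ideal_transform_map _ _ _).
- move=> U u; rewrite -[u]quotmod_projK direct_limit_mapE; congr (quotmod_proj _ _); apply: val_inj.
  by apply: functional_extensionality_dep => n; apply: linear_ext.
- move=> U V W f g u; rewrite -[u]quotmod_projK; move: (repr u) => z.
  rewrite !(direct_limit_mapE _ z) direct_limit_mapE; congr (quotmod_proj _ _); apply: val_inj.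
  by apply: functional_extensionality_dep => n; apply: linear_ext.
- move=> U V f g u; rewrite -[u]quotmod_projK; move: (repr u) => z; rewrite !direct_limit_mapE -linearD; congr (quotmod_proj _ _).
  apply: val_inj; apply: functional_extensionality_dep => n; exact: linear_ext.
Defined.

Definition derived_ideal_transform i (N : lmodType R) (E : injective_resolution N) :
    lmodType R :=
  right_derived E ideal_transform_functor i.

End Powers.

Section Primes.
Variable R : comNzRingType.

Definition prime_ideal (p : {pred R}) : Prop :=
  idealr_closed p /\ prime_idealr_closed p.

(* p is associated to V when p = Ann x for some x in V. Sets of primes are sets of
   R -> bool because {pred R} lives in a universe too large for [set]. *)
Definition Ass (V : lmodType R) : set (R -> bool) :=
  [set p : R -> bool | prime_ideal p /\
    exists x : V, forall a, p a = (a *: x == 0)]%classic.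

(* The localization V_p, as the set of fractions x/s with s outside p *)

Section Localization.
Variables (p : {pred R}) (pP : prime_ideal p) (V : lmodType R).

Definition fraction : Type := {xs : V * R | xs.2 \notin p}.

Definition mkfraction (x : V) (s : R) (sp : s \notin p) : fraction :=
  exist _ (x, s) sp.

Definition frac_eq (f g : fraction) : bool :=
  `[< exists2 u, u \notin p &
        u *: ((val g).2 *: (val f).1) = u *: ((val f).2 *: (val g).1) >].

Fact prime1 : 1 \notin p. Proof. by case: pP => -[]. Qed.

Fact primeM u v : u \notin p -> v \notin p -> u * v \notin p.
Proof.
by case: pP => _ pM up vp; apply/negP => /pM; rewrite (negbTE up) (negbTE vp).
Qed.

Fact frac_eq_equiv : equiv_class_of frac_eq.
Proof.
split=> [f|f g|g f h].
- by apply/asboolP; exists 1; rewrite ?prime1.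
- by apply/asboolP/asboolP => -[u up e]; exists u.
- move=> /asboolP[u up e] /asboolP[v vp e']; apply/asboolP.
  exists (u * v * (val g).2); first by rewrite !primeM // (valP g).
  have E1 : u * v * (val g).2 *: ((val h).2 *: (val f).1) =
      (v * (val h).2) *: (u *: ((val g).2 *: (val f).1)).
    by rewrite !scalerA; congr (_ *: _); ring.
  have E2 : u * v * (val g).2 *: ((val f).2 *: (val h).1) =
      (u * (val f).2) *: (v *: ((val g).2 *: (val h).1)).
    by rewrite !scalerA; congr (_ *: _); ring.
  rewrite E1 E2 e -e' !scalerA; congr (_ *: _); ring.
Qed.

Canonical frac_equiv := EquivRelPack frac_eq_equiv.
Canonical frac_encModRel := defaultEncModRel frac_eq.

Definition localization := {eq_quot frac_eq}.

Definition loc0 : localization := \pi_localization (mkfraction 0 prime1).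

End Localization.

(* V_p <> 0 *)
Definition Supp (V : lmodType R) : set (R -> bool) :=
  [set p : R -> bool | exists (pP : prime_ideal p) (z : localization pP V),
    z <> loc0 pP V]%classic.

Definition fin_gen (V : lmodType R) (S : submodClosed V) : Prop :=
  exists s : seq V, S =i submod_span [set` s]%classic.

Definition noetherian_ring : Prop := forall J : submodClosed R^o, fin_gen J.

Definition finitely_generated (M : lmodType R) : Prop := fin_gen (submod_full M).

(* The quotient modules of N are, up to isomorphism, the targets of the surjective
   linear maps from N. *)
Definition weakly_laskerian (N : lmodType R) : Prop :=
  forall (Q : lmodType R) (f : {linear N -> Q}),
    (forall y, exists x, f x = y) -> finite_set (Ass Q).

Definition maximal_ideal (m : {pred R}) : Prop :=
  idealr_closed m /\
  forall J : {pred R}, idealr_closed J -> {subset m <= J} -> J =i m.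

End Primes.

(* Main.v *)
Require Import Defs.
From mathcomp Require Import all_boot all_algebra ring_quotient.
From mathcomp Require Import boolp classical_sets functions cardinality.

(* An element of H^i_m(M, N) comes from some Ext^i(M / m^n M, N), hence is killed
   by m^n, so the support is contained in {m}.

   A class q in R^i D_m(M, N) is represented by a cocycle f : m^n M -> E^i. Extend
   f to g : M -> E^i. For b in m^n the multiple b g is a cocycle on M restricting
   to b f, so b q lies in the image of Ext^i(M, N). If p = Ann q is not m, then b
   can be chosen outside p and p = Ann (b q). Hence every associated prime other
   than m is associated to a quotient of Ext^i(M, N). That module is weakly
   Laskerian: Hom(M, N) embeds in a finite power of N, and for
   0 -> K -> R^n -> M -> 0 the module Ext^(i+1)(M, N) is a quotient of Ext^i(K, N). *)

Set Implicit Arguments.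
Unset Strict Implicit.
Unset Printing Implicit Defensive.

Import GRing.Theory.
Local Open Scope ring_scope.

(** * Membership in submodules *)

Lemma submod_addl (R : comNzRingType) (V : lmodType R) (S : submodClosed V) x y :
  x \in S -> (x + y \in S) = (y \in S).
Proof.
move=> xS; apply/idP/idP => [xyS|]; last exact: rpredD.
by rewrite -[y](addKr x) -scaleN1r rpredD ?rpredZ.
Qed.

Lemma submod_imP (R : comNzRingType) (V W : lmodType R) (f : {linear V -> W}) y :
  reflect (exists x, f x = y) (y \in submod_im f).
Proof. exact: mkSubmodP. Qed.

Lemma submod_preimP (R : comNzRingType) (V W : lmodType R) (f : {linear V -> W})
    (S : submodClosed W) x :
  (x \in submod_preim f S) = (f x \in S).
Proof. by apply/mkSubmodP/idP. Qed.

Lemma submod_kerP (R : comNzRingType) (V W : lmodType R) (f : {linear V -> W}) x :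
  reflect (f x = 0) (x \in submod_ker f).
Proof. exact: mkSubmodP. Qed.

(** * Weakly Laskerian subquotients and their associated primes *)

Section Laskerian.
Variable R : comNzRingType.
Implicit Types U V W : lmodType R.

(** A prime of the form [(T : x)] is the annihilator of the class of [x] in [V / T], so these are
    the associated primes of [(Z + T) / T] when [Z] is a submodule. *)
Definition colon_primes V (T : submodClosed V) (Z : V -> Prop) : set (R -> bool) :=
  [set p : R -> bool | prime_ideal p /\
    exists2 x : V, Z x & forall a, p a = (a *: x \in T)]%classic.

(* For submodules [B] and [Z], this says that (Z + B) / B is weakly Laskerian;
   subquotients of a fixed module thus need not be formed. *)
Definition laskerian_mod V (Z B : V -> Prop) : Prop :=
  forall T : submodClosed V, (forall x, B x -> x \in T) ->
    finite_set (colon_primes T Z).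

Lemma weakly_laskerianP V :
  weakly_laskerian V -> laskerian_mod (fun _ : V => True) (fun x => x = 0).
Proof.
move=> wV T _; have := wV _ (quotmod_proj T).
move=> /(_ (fun y => ex_intro _ (repr y) (quotmod_projK y))).
apply: sub_finite_set => p [pP [x _ px]]; split=> //.
exists (quotmod_proj T x) => a.
by rewrite px -linearZ quotmod_proj_eq0.
Qed.

(* The linear relation [r] makes (ZW + BW) / BW a subquotient of (ZV + BV) / BV;
   a relation can replace a connecting map that is awkward to build as a function. *)
Lemma laskerian_mod_transfer V W (r : V -> W -> Prop) (ZV BV : V -> Prop)
    (ZW BW : W -> Prop) :
  r 0 0 -> (forall a x y x' y', r x y -> r x' y' -> r (a *: x + x') (a *: y + y')) ->
  BV 0 -> (forall a x y, BV x -> BV y -> BV (a *: x + y)) ->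
  (forall w, ZW w -> exists2 v, ZV v & r v w) ->
  (forall v w, r v w -> BV v -> BW w) ->
  laskerian_mod ZV BV -> laskerian_mod ZW BW.
Proof.
move=> r0 rL B0 BL Zr Br lV T BT.
(* [P] is [BV] plus the preimage of [T] under the relation; it is the submodule of [V] to which the
   hypothesis on [V] is applied. *)
pose P v := exists b v' w, [/\ BV b, w \in T, r v' w & v = b + v'].
have P0 : P 0 by exists 0, 0, 0; rewrite rpred0 addr0.
have PL a x y : P x -> P y -> P (a *: x + y).
  move=> [b [v [w [bB wT vw ->]]]] [b' [v' [w' [bB' wT' vw' ->]]]].
  exists (a *: b + b'), (a *: v + v'), (a *: w + w'); split.
  - exact: BL.
  - by rewrite rpredD ?rpredZ.
  - exact: rL.
  - by rewrite scalerDr addrACA.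
have BP v : BV v -> v \in mkSubmod P0 PL.
  by move=> vB; apply/mkSubmodP; exists v, 0, 0; rewrite rpred0 addr0.
apply: sub_finite_set (lV _ BP) => p [pP [w wZ pw]]; split=> //.
have [v vZ vw] := Zr w wZ; exists v => // a; rewrite pw.
have ravw : r (a *: v) (a *: w) by rewrite -[a *: v]addr0 -[a *: w]addr0; exact: rL.
apply/idP/mkSubmodP => [awT|[b [v' [w' [bB wT' vw' avE]]]]].
  by exists 0, (a *: v), (a *: w); rewrite add0r.
(* Subtracting the pair [v'], [w'] relates [b] in [BV] to [a *: w - w'], which therefore lies in
   [BW] and so in [T]. *)
have /Br : r (-1 *: v' + a *: v) (-1 *: w' + a *: w) by exact: rL.
rewrite avE addrCA scaleN1r addNr addr0 => /(_ bB) /BT wT.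
by rewrite scaleN1r submod_addl // -scaleN1r rpredZ // in wT.
Qed.

Lemma prime_nmemM (p : {pred R}) u v : prime_ideal p -> u \notin p -> (v * u \in p) = (v \in p).
Proof.
move=> [[p0 _ pL] pM] up; apply/idP/idP => [/pM|vp]; first by rewrite (negbTE up) orbF.
by rewrite -[v * u]addr0 mulrC; exact: pL.
Qed.

(** This is the inclusion of the associated primes of an extension in those of the submodule and of
    the quotient. Let [p = (T : x)]. If some multiple [c *: x] with [c] outside [p] falls into
    [T + K'], its [K'] component has colon ideal [p]; otherwise [p = (T + K' : x)]. *)
Lemma laskerian_mod_ext V (K K' B : V -> Prop) :
  K' 0 -> (forall a x y, K' x -> K' y -> K' (a *: x + y)) ->
  laskerian_mod K' B -> laskerian_mod K K' -> laskerian_mod K B.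
Proof.
move=> K0 KL lK' lK T BT.
pose P v := exists t k, [/\ t \in T, K' k & v = t + k].
have P0 : P 0 by exists 0, 0; rewrite rpred0 addr0.
have PL a x y : P x -> P y -> P (a *: x + y).
  move=> [t [k [tT kK ->]]] [t' [k' [tT' kK' ->]]].
  exists (a *: t + t'), (a *: k + k'); split; [|exact: KL|].
  - by rewrite rpredD ?rpredZ.
  - by rewrite scalerDr addrACA.
have KP v : K' v -> v \in mkSubmod P0 PL.
  by move=> vB; apply/mkSubmodP; exists 0, v; rewrite rpred0 add0r.
have fin : finite_set (colon_primes T K' `|` colon_primes (mkSubmod P0 PL) K)%classic.
  by rewrite finite_setU; split; [exact: lK'|exact: lK].
apply: sub_finite_set fin => p [pP [x xK px]].
have [[c cp [t [k [tT kK cx]]]]|none] :=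
    pselect (exists2 c, c \notin (p : {pred R}) & P (c *: x)); [left|right]; split=> //.
  (* Primality gives [a * c] in [p] exactly when [a] is, and [c *: x] differs from [k] by an element
     of [T]. *)
  exists k => // a; rewrite -[p a]/(a \in (p : {pred R})) -(prime_nmemM a pP cp).
  rewrite -[LHS]/(p (a * c)) px -scalerA cx scalerDr.
  by rewrite submod_addl // rpredZ.
exists x => // a; apply/idP/mkSubmodP => [pa|Pa].
  by exists (a *: x), 0; rewrite addr0 -px.
by apply: contrapT => /negP pa; apply: none; exists a.
Qed.

End Laskerian.

(** * Finite generation over a Noetherian ring *)

Section Noetherian.
Variable R : comNzRingType.
Implicit Types U V W : lmodType R.

Lemma submod_span_gen V (A : set V) x : A x -> x \in submod_span A.
Proof. by move=> Ax; apply/submod_spanP => S; apply. Qed.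

Lemma submod_span_min V (A : set V) (S : submodClosed V) :
  (forall x, A x -> x \in S) -> {subset submod_span A <= S}.
Proof. by move=> AS x /submod_spanP; apply. Qed.

(** Induction on [s]. The coefficients of the head [a] in elements of [S], modulo the span [U] of
    the tail, form an ideal. Lifts to [S] of finitely many generators of this ideal, together with
    generators of the intersection of [S] and [U], generate [S]. *)
Lemma noetherian_submod V (s : seq V) (S : submodClosed V) : noetherian_ring R ->
  {subset S <= submod_span [set` s]%classic} -> fin_gen S.
Proof.
move=> noeR; elim: s S => [|a s IH] S Ss.
  exists [::] => x; apply/idP/idP; first exact: Ss.
  by apply: submod_span_min.
set U := submod_span [set` s]%classic in IH.
have consP x : x \in submod_span [set` a :: s]%classic -> exists2 c, x - c *: a \in U & True.
  have P0 : exists2 c, 0 - c *: a \in U & True.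
    by exists 0; rewrite // scale0r subrr rpred0.
  have PL b u v : (exists2 c, u - c *: a \in U & True) ->
      (exists2 c, v - c *: a \in U & True) -> exists2 c, b *: u + v - c *: a \in U & True.
    move=> [c cU _] [d dU _]; exists (b * c + d) => //.
    by rewrite scalerDl -scalerA opprD addrACA -scalerBr rpredD ?rpredZ.
  move=> /(submod_span_min (S := mkSubmod P0 PL)) - /(_ _)/mkSubmodP; apply => y /=.
  rewrite inE => /predU1P[->|ys]; apply/(mkSubmodP P0 PL).
    by exists 1; rewrite // scale1r subrr rpred0.
  by exists 0; rewrite // scale0r subr0; apply: submod_span_gen.
pose P (c : R^o) := exists2 x, x \in S & x - (c : R) *: a \in U.
have P0 : P 0 by exists 0; rewrite ?scale0r ?subrr rpred0.
have PL b c d : P c -> P d -> P (b *: c + d).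
  move=> [x xS xU] [y yS yU]; exists (b *: x + y); first by rewrite rpredD ?rpredZ.
  by rewrite [(_ + _ : R^o) *: a]scalerDl -scalerA opprD addrACA -scalerBr rpredD ?rpredZ.
have [cs csP] := noeR (mkSubmod P0 PL).
(* [f] lifts each coefficient of the ideal to an element of [S]; outside the ideal the value 0 is a
   dummy. *)
have /choice[f fP] : forall c : R, exists v, P c -> v \in S /\ v - c *: a \in U.
  by move=> c; have [[v vS vU]|nP] := pselect (P c); [exists v|exists 0].
have SU0 : 0 \in S /\ 0 \in U by rewrite !rpred0.
have SUL b x y : x \in S /\ x \in U -> y \in S /\ y \in U ->
    b *: x + y \in S /\ b *: x + y \in U.
  by move=> [xS xU] [yS yU]; rewrite !rpredD ?rpredZ.
have [|t tP] := IH (@mkSubmod R V (fun x => x \in S /\ x \in U) SU0 SUL).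
  by move=> x /(mkSubmodP SU0 SUL)[].
exists (map f cs ++ t) => x; apply/idP/idP; last first.
  apply: submod_span_min => y /=; rewrite mem_cat => /orP[/mapP[c cs_c ->]|yt].
    apply: (fP c _).1; apply/(mkSubmodP P0 PL).
    by rewrite csP; exact: submod_span_gen.
  suff /(mkSubmodP SU0 SUL)[] : y \in mkSubmod SU0 SUL by [].
  by rewrite tP; exact: submod_span_gen.
move=> xS; have /consP[c xU _] := Ss x xS.
pose G := submod_span [set` map f cs]%classic.
(* A combination [y] of the lifts has the same coefficient as [x], so [x - y] falls into both [S]
   and [U]. *)
have [y yG ycU] : exists2 y, y \in G & y - c *: a \in U.
  pose Q (d : R^o) := exists2 y, y \in G & y - (d : R) *: a \in U.
  have Q0 : Q 0 by exists 0; rewrite ?scale0r ?subrr rpred0.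
  have QL b d d' : Q d -> Q d' -> Q (b *: d + d').
    move=> [y yG yU] [z zG zU]; exists (b *: y + z); first by rewrite rpredD ?rpredZ.
    by rewrite [(_ + _ : R^o) *: a]scalerDl -scalerA opprD addrACA -scalerBr rpredD ?rpredZ.
  have : (c : R^o) \in submod_span [set` cs]%classic.
    by rewrite -csP; apply/(mkSubmodP P0 PL); exists x.
  move=> /(submod_span_min (S := mkSubmod Q0 QL)) h.
  have /(mkSubmodP Q0 QL)// : (c : R^o) \in mkSubmod Q0 QL.
  apply: h => d /= dcs; apply/(mkSubmodP Q0 QL); exists (f d).
    by apply: submod_span_gen; exact: map_f.
  apply: (fP d _).2; apply/(mkSubmodP P0 PL).
  by rewrite csP; exact: submod_span_gen.
have Gsub : {subset G <= submod_span [set` map f cs ++ t]%classic}.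
  by apply: submod_span_min => z /= zG; apply: submod_span_gen; rewrite /= mem_cat zG.
have GS : {subset G <= S}.
  apply: submod_span_min => z /= /mapP[d dcs ->]; apply: (fP d _).1.
  by apply/(mkSubmodP P0 PL); rewrite csP; exact: submod_span_gen.
rewrite -(subrK y x) rpredD //; last exact: Gsub.
suff : x - y \in submod_span [set` t]%classic.
  apply: submod_span_min => z zt; apply: submod_span_gen.
  by rewrite /= mem_cat [z \in t]zt orbT.
rewrite -tP; apply/(mkSubmodP SU0 SUL); split.
  by rewrite -scaleN1r rpredD ?rpredZ // GS.
rewrite (_ : x - y = (x - c *: a) + (-1) *: (y - c *: a)).
  by apply: rpredD => //; exact: rpredZ.
by rewrite scaleN1r opprB addrA subrK.
Qed.

Lemma finitely_generated_submod V (S : submodClosed V) : fin_gen S -> finitely_generated (submod S).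
Proof.
(* The generators all lie in [S], so [pmap insub] drops none of them. *)
move=> [s sP]; exists (pmap insub s) => x; rewrite [LHS](_ : _ = true); last exact/mkSubmodP.
apply/esym/submod_spanP => T Ts.
pose P (y : V) := exists2 z : submod S, z \in T & val z = y.
have P0 : P 0 by exists 0; rewrite ?rpred0 ?linear0.
have PL a u v : P u -> P v -> P (a *: u + v).
  move=> [y yT <-] [z zT <-]; exists (a *: y + z); first by rewrite rpredD ?rpredZ.
  by [].
have : val x \in submod_span [set` s]%classic by rewrite -sP (valP x).
move=> /(submod_span_min (S := mkSubmod P0 PL)) h.
have /(mkSubmodP P0 PL) : val x \in mkSubmod P0 PL.
  apply: h => y /= ys; apply/(mkSubmodP P0 PL).
  have yS : y \in S by rewrite sP; exact: submod_span_gen.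
  exists (Sub y yS); last exact: SubK.
  by apply: Ts; rewrite /= mem_pmap_sub.
by move=> [z zT /val_inj <-].
Qed.

Lemma row_basis_lift n V (v : 'I_n -> V) :
  exists f : {linear 'rV[R]_n -> V}, forall i, f (delta_mx 0 i) = v i.
Proof.
have fL : linear (fun x : 'rV[R]_n => \sum_i x 0 i *: v i).
  move=> a x y; rewrite scaler_sumr -big_split; apply: eq_bigr => i _ /=.
  by rewrite !mxE scalerDl scalerA.
exists (mkLinear fL) => i; rewrite /= (bigD1 i) //= mxE !eqxx scale1r big1 ?addr0 // => j ji.
by rewrite mxE (negbTE ji) andbF scale0r.
Qed.

Lemma row_linear_ext n V (f g : {linear 'rV[R]_n -> V}) :
  (forall i, f (delta_mx 0 i) = g (delta_mx 0 i)) -> f =1 g.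
Proof.
move=> fg x; rewrite (row_sum_delta x) !linear_sum; apply: eq_bigr => i _.
by rewrite !linearZ /= fg.
Qed.

Lemma finitely_generated_cover V : finitely_generated V ->
  exists n (f : {linear 'rV[R]_n -> V}), forall y, exists x, f x = y.
Proof.
move=> [s sP]; exists (size s).
have [f fE] := row_basis_lift (fun i : 'I_(size s) => nth 0 s i).
exists f => y; suff /submod_imP : y \in submod_im f by [].
have : y \in submod_span [set` s]%classic by rewrite -sP; exact/mkSubmodP.
apply: submod_span_min => x /= xs; apply/submod_imP.
have xi : (index x s < size s)%N by rewrite index_mem.
by exists (delta_mx 0 (Ordinal xi)); rewrite fE /= nth_index.
Qed.

Lemma noetherian_row n (S : submodClosed 'rV[R]_n) : noetherian_ring R -> fin_gen S.
Proof.
move=> noeR; apply: (@noetherian_submod _ [seq delta_mx 0 i | i : 'I_n]) => // x _.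
apply/submod_spanP => T Ts; rewrite (row_sum_delta x) rpred_sum // => i _.
by rewrite rpredZ // Ts //= map_f // mem_enum.
Qed.

End Noetherian.

(** * The modules Ext^i(M, N) are weakly Laskerian *)

Section HomCohomology.
Variables (R : comNzRingType) (N : lmodType R) (E : injective_resolution N).
Implicit Types M F W : lmodType R.

(** The composite of [f] with a merely set-theoretic section of [pi] is linear, because [f x]
    depends only on [pi x]. *)
Lemma linear_factor F M W (pi : {linear F -> M}) (f : {linear F -> W}) :
  (forall y, exists x, pi x = y) -> (forall x, pi x = 0 -> f x = 0) ->
  exists g : {linear M -> W}, forall x, g (pi x) = f x.
Proof.
move=> /choice[s sK] fker.
have fE x y : pi x = pi y -> f x = f y.
  move=> xy; apply/eqP; rewrite -subr_eq0 -linearB fker // linearB xy.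
  exact: subrr.
have gL : linear (fun y => f (s y)).
  by move=> a x y; rewrite -linearP; apply: fE; rewrite linearP !sK.
by exists (mkLinear gL) => x; apply: fE; rewrite sK.
Qed.

Lemma injective_extend F W (S : submodClosed F) (g : {linear submod S -> W}) :
  injective_module W -> exists h : {linear F -> W}, forall x, h (val x) = g x.
Proof. by move=> /(_ _ _ (submod_incl S) g); apply; exact: val_inj. Qed.

Definition hom_cocycle i M (f : Defs.Hom M (E i)) : Prop :=
  forall x, rdiff E i ((f : {linear M -> E i}) x) = 0.

(** Together with [hom_cocycle] this presents Ext^i(M, N) as a subquotient of Hom(M, E^i); no
    differential enters degree 0. *)
Definition hom_coboundary i M : Defs.Hom M (E i) -> Prop :=
  match i with
  | 0 => fun f => f = 0
  | i.+1 => fun f => exists g : {linear M -> E i},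
      forall x, rdiff E i (g x) = (f : {linear M -> E i.+1}) x
  end.

Lemma hom_coboundary0 i M : hom_coboundary (0 : Defs.Hom M (E i)).
Proof. by case: i => [|i] //=; exists \0 => x; rewrite /= linear0. Qed.

Lemma hom_coboundaryP i M a (f g : Defs.Hom M (E i)) :
  hom_coboundary f -> hom_coboundary g -> hom_coboundary (a *: f + g).
Proof.
case: i f g => [|i] f g /=; first by move=> -> ->; rewrite scaler0 addr0.
move=> [f' fE] [g' gE]; exists (a \*: f' \+ g') => x.
by rewrite /= linearP fE gE.
Qed.

(** Evaluation at the elements of [s] embeds [K] in a finite power of [N]. A general [K] is needed
    for the induction, which passes to the maps that vanish at the head [y]. *)
Lemma laskerian_hom_kernel M (s : seq M) (K : Defs.Hom M (E 0) -> Prop) :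
  weakly_laskerian N -> K 0 ->
  (forall a f g, K f -> K g -> K (a *: f + g)) ->
  (forall f, K f -> hom_cocycle f) ->
  (forall f : Defs.Hom M (E 0), K f ->
    (forall x, x \in s -> (f : {linear M -> E 0}) x = 0) -> f = 0) ->
  laskerian_mod K (fun f => f = 0).
Proof.
move=> wN; elim: s K => [|y s IH] K K0 KL Kd Ks.
  (* Here [K] is zero, so an associated prime would contain 1. *)
  move=> T _; apply: sub_finite_set (@finite_set0 (R -> bool)) => p [[[_ p1 _] _] [f fK pf]].
  have f0 : f = 0 by exact: Ks.
  by move/negP: p1; apply; rewrite -topredE /= pf f0 scaler0 rpred0.
pose K' f := K f /\ (f : {linear M -> E 0}) y = 0.
have K'0 : K' 0 by [].
have K'L a f g : K' f -> K' g -> K' (a *: f + g).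
  move=> [fK fy] [gK gy]; split; first exact: KL.
  by rewrite [LHS](_ : _ = a *: (f : {linear M -> E 0}) y + (g : {linear M -> E 0}) y)
    // fy gy scaler0 addr0.
apply: (laskerian_mod_ext K'0 K'L).
  apply: IH => // [f [fK _]|f [fK fy] fs]; first exact: Kd.
  by apply: Ks => // x; rewrite inE => /predU1P[->|] //; exact: fs.
(* A degree 0 cocycle takes values in the image of [N], so evaluation at [y] embeds [K / K'] in [N];
   [r] is the inverse relation. *)
pose r (n : N) (f : Defs.Hom M (E 0)) := K f /\ raug E n = (f : {linear M -> E 0}) y.
apply: (@laskerian_mod_transfer R N (Defs.Hom M (E 0)) r
  (fun=> True) (fun n => n = 0)) (weakly_laskerianP wN) => //.
- by split=> //; rewrite linear0.
- move=> a n f n' f' [fK nf] [fK' nf']; split; first exact: KL.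
  by rewrite linearP nf nf'.
- by move=> a x z -> ->; rewrite scaler0 addr0.
- by move=> f fK; have /raug_exact[n nf] := Kd f fK y; exists n.
- by move=> n f [fK nf] n0; split=> //; rewrite -nf n0 linear0.
Qed.

Lemma laskerian_hom_cohomology0 M : weakly_laskerian N -> finitely_generated M ->
  laskerian_mod (@hom_cocycle 0 M) (@hom_coboundary 0 M).
Proof.
move=> wN [s sP]; apply: (@laskerian_hom_kernel M s) => //.
- by move=> x; exact: linear0.
- move=> a f g fK gK x.
  rewrite [X in rdiff E 0 X](_ : _ = a *: (f : {linear M -> E 0}) x + (g : {linear M -> E 0}) x) //.
  by rewrite linearP fK gK scaler0 addr0.
- move=> f _ fs; apply: linear_ext => x; apply/submod_kerP.
  have : x \in submod_span [set` s]%classic by rewrite -sP; exact/mkSubmodP.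
  by apply: submod_span_min => y ys; apply/submod_kerP/fs.
Qed.

(* Dimension shifting for 0 -> K -> F -> M -> 0 with F free: the connecting map
   Ext^i(K, N) -> Ext^(i+1)(M, N) is onto. It is used as a linear relation. *)
Lemma laskerian_hom_shift i n M (pi : {linear 'rV[R]_n -> M}) :
  (forall y, exists x, pi x = y) ->
  laskerian_mod (@hom_cocycle i (submod (submod_ker pi))) (@hom_coboundary i _) ->
  laskerian_mod (@hom_cocycle i.+1 M) (@hom_coboundary i.+1 M).
Proof.
move=> pi_surj; set S := submod_ker pi.
(* The zigzag of the snake lemma: [h] extends [g] to the free module, and its differential descends
   along [pi] to [f]. *)
pose r (g : Defs.Hom (submod S) (E i)) (f : Defs.Hom M (E i.+1)) :=
  exists h : {linear 'rV[R]_n -> E i},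
    (forall x, h (val x) = (g : {linear submod S -> E i}) x) /\
    (forall x, rdiff E i (h x) = (f : {linear M -> E i.+1}) (pi x)).
apply: (@laskerian_mod_transfer R _ _ r).
- by exists \0; split=> x //=; rewrite linear0.
- move=> a g f g' f' [h [hg hf]] [h' [hg' hf']].
  exists (a \*: h \+ h'); split=> x /=; first by rewrite hg hg'.
  by rewrite linearP hf hf'.
- exact: hom_coboundary0.
- by move=> a x y; exact: hom_coboundaryP.
- move=> f fZ.
  (* The values of the cocycle [f] are boundaries in the exact resolution; preimages chosen on the
     basis define [h] by freeness. *)
  have /choice[v vE] : forall j : 'I_n, exists y,
      rdiff E i y = (f : {linear M -> E i.+1}) (pi (delta_mx 0 j)).
    by move=> j; apply/rdiff_exact.
  have [h hE] := row_basis_lift v.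
  have dh x : rdiff E i (h x) = (f : {linear M -> E i.+1}) (pi x).
    apply: (@row_linear_ext R n _ (rdiff E i \o h) ((f : {linear M -> E i.+1}) \o pi)).
    by move=> j /=; rewrite hE.
  pose g : {linear submod S -> E i} := h \o submod_incl S.
  exists (g : Defs.Hom (submod S) (E i)); last by exists h.
  by move=> x /=; rewrite dh (submod_kerP _ _ (valP x)) linear0.
- move=> g f [h [hg hf]] gB.
  (* Such an [h'] factors through [pi], and the factor has [f] as its coboundary. *)
  suff [h' [hS hd]] : exists h' : {linear 'rV[R]_n -> E i},
      (forall x, pi x = 0 -> h' x = 0) /\ (forall x, rdiff E i (h' x) = rdiff E i (h x)).
    have [f' f'E] := linear_factor pi_surj hS.
    by exists f' => y; have [x <-] := pi_surj y; rewrite f'E hd hf.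
  have hS x (xS : pi x = 0) :
      h x = (g : {linear submod S -> E i}) (Sub x (introT (submod_kerP _ _) xS)).
    by rewrite -hg SubK.
  (* In degree 0 the coboundary [g] is zero and [h] itself works. In higher degrees [g] is the
     differential of some [g']; the differential of an extension [k] of [g'] is subtracted from
     [h]. *)
  case: i g f r h hg hf gB hS => [|i] g f r h hg hf gB hS.
    by exists h; split=> // x xS; rewrite hS gB.
  have [g' g'E] := gB.
  have [k kE] := injective_extend g' (@robj_inj _ _ E i).
  exists (h \+ (-1 \*: (rdiff E i \o k))); split=> x.
    by move=> xS; rewrite /= hS -g'E -kE SubK scaleN1r subrr.
  rewrite /= linearD linearZ /=.
  have /(rdiff_exact (rdiff E i (k x))) -> :
    exists y, rdiff E i y = rdiff E i (k x) by exists (k x).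
  by rewrite scaler0 addr0.
Qed.

(** The induction on [i] ranges over all [M], since a step replaces [M] by the kernel of a finite
    free cover, finitely generated because [R] is Noetherian. *)
Lemma laskerian_hom_cohomology i M : noetherian_ring R -> weakly_laskerian N ->
  finitely_generated M -> laskerian_mod (@hom_cocycle i M) (@hom_coboundary i M).
Proof.
move=> noeR wN; elim: i M => [|i IH] M fgM; first exact: laskerian_hom_cohomology0.
have [n [pi pi_surj]] := finitely_generated_cover fgM.
apply: (laskerian_hom_shift pi_surj); apply: IH.
exact/finitely_generated_submod/noetherian_row.
Qed.

End HomCohomology.

(** * Elements of sequential direct limits *)

Arguments single [R] V [n] x.

Section DirectLimitElements.
Variable R : comNzRingType.
Implicit Types V W : direct_system R.

Fact single_direct_sum V n (x : V n) : single V x \in direct_sum V.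
Proof.
apply/mkSubmodP; exists n.+1 => k nk.
by rewrite /single eqtype.dfwith_out // neq_ltn nk.
Qed.

Fact single_linear V n : linear (fun x : V n => single V x).
Proof.
move=> a x y; apply: functional_extensionality_dep => k.
rewrite [RHS](_ : _ = a *: single V x k + single V y k) //.
have [<-|nk] := eqVneq n k; first by rewrite /single !eqtype.dfwith_in.
by rewrite /single !eqtype.dfwith_out // scaler0 addr0.
Qed.

Definition sum_inj V n (x : V n) : submod (direct_sum V) :=
  exist _ (single V x) (single_direct_sum x).

Fact limit_inj_linear V n :
  linear (fun x : V n => quotmod_proj (direct_limit_rel V) (sum_inj x)).
Proof.
move=> a x y; rewrite -linearP; congr (quotmod_proj _ _).
by apply: val_inj; rewrite /= single_linear.
Qed.

Definition limit_inj V n : {linear V n -> direct_limit V} := mkLinear (@limit_inj_linear V n).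

Lemma limit_injE V n (x : V n) :
  limit_inj V n x = quotmod_proj (direct_limit_rel V) (sum_inj x).
Proof. by []. Qed.

Lemma limit_inj_dmap V n (x : V n) : limit_inj V n.+1 (dmap V n x) = limit_inj V n x.
Proof.
apply/esym/eqP; rewrite -subr_eq0 !limit_injE -linearB quotmod_proj_eq0.
by apply: submod_span_gen; exists n, x.
Qed.

Lemma direct_limit_map_inj V W (f : forall n, {linear V n -> W n})
    (fE : forall n x, f n.+1 (dmap V n x) = dmap W n (f n x)) n x :
  direct_limit_map fE (limit_inj V n x) = limit_inj W n (f n x).
Proof.
rewrite !limit_injE direct_limit_mapE; congr (quotmod_proj _ _); apply: val_inj.
exact: direct_prod_map_single.
Qed.

(** The sum in [V k] of the images of the components up to index [k]. On [single V x] with [x] in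
    [V n] and [n <= k] it is the composite transition map, with no cast between indices. *)
Fixpoint push V (x : direct_prod V) k : V k :=
  if k is k'.+1 then dmap V k' (push x k') + x k'.+1 else x 0%N.

Lemma push_linear V k : linear (fun x : direct_prod V => push x k).
Proof.
elim: k => [|k IH] a x y //=.
by rewrite IH linearP scalerDr addrACA.
Qed.

Lemma push_single_lt V n (x : V n) k : (k < n)%N -> push (single V x) k = 0.
Proof.
elim: k => [|k IH] /= kn; first by rewrite /single eqtype.dfwith_out // -lt0n.
by rewrite IH ?(ltnW kn) // linear0 add0r /single eqtype.dfwith_out // gtn_eqF.
Qed.

Lemma push_single_diag V n (x : V n) : push (single V x) n = x.
Proof.
case: n x => [|n] x /=; first by rewrite /single eqtype.dfwith_in.
by rewrite push_single_lt // linear0 add0r /single eqtype.dfwith_in.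
Qed.

Lemma push_singleS V n (x : V n) k : (n <= k)%N ->
  push (single V x) k.+1 = dmap V k (push (single V x) k).
Proof. by move=> nk; rewrite /= {2}/single eqtype.dfwith_out ?addr0 // ltn_eqF. Qed.

Lemma limit_inj_push V n (x : V n) k : (n <= k)%N ->
  limit_inj V k (push (single V x) k) = limit_inj V n x.
Proof.
move=> /subnK <-; elim: (k - n)%N => [|j IH]; first by rewrite push_single_diag.
by rewrite addSn push_singleS ?leq_addl // limit_inj_dmap.
Qed.

(** The elements of the direct sum whose pushes eventually vanish form a submodule containing the
    defining relations. *)
Lemma limit_inj_eq0 V n (x : V n) : limit_inj V n x = 0 ->
  exists2 k, (n <= k)%N & push (single V x) k = 0.
Proof.
move/eqP; rewrite limit_injE quotmod_proj_eq0.
pose P (z : submod (direct_sum V)) := exists K, forall k, (K <= k)%N -> push (val z) k = 0.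
have P0 : P 0 by exists 0%N => k _; exact: (linear0 (mkLinear (@push_linear V k))).
have PL a y z : P y -> P z -> P (a *: y + z).
  move=> [K yK] [L zL]; exists (maxn K L) => k; rewrite geq_max => /andP[Kk Lk].
  by rewrite [LHS]push_linear yK // zL // scaler0 addr0.
move=> /(submod_span_min (S := mkSubmod P0 PL)) h.
have /(mkSubmodP P0 PL)[K xK] : sum_inj x \in mkSubmod P0 PL.
  (* At index [j] only the first term of the relation is seen; from [j.+1] on the two pushes
     cancel. *)
  apply: h => z [j [y zE]]; apply/(mkSubmodP P0 PL); exists j.+1 => k jk.
  rewrite zE -scaleN1r addrC push_linear scaleN1r addrC; apply/eqP; rewrite subr_eq0; apply/eqP.
  move: jk => /subnK <-; elim: (k - j.+1)%N => [|l IH].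
    by rewrite push_singleS // !push_single_diag.
  by rewrite addSn !push_singleS ?leq_addl ?IH // (leq_trans (leqnSn j)) // leq_addl.
by exists (maxn n K); rewrite ?leq_maxl // xK // leq_maxr.
Qed.

(** The class of a truncation at [k] comes from the push at stage [k], and a finitely supported
    representative equals one of its truncations. *)
Lemma limit_inj_surj V (u : direct_limit V) : exists n (x : V n), u = limit_inj V n x.
Proof.
pose w := repr u; have [K wK] := mkSubmodP _ _ _ (valP w).
pose trunc k : direct_prod V := fun n => if (n <= k)%N then val w n else 0.
have truncS k : trunc k \in direct_sum V.
  by apply/mkSubmodP; exists k.+1 => n kn; rewrite /trunc leqNgt kn.
have truncE k : quotmod_proj (direct_limit_rel V) (exist _ (trunc k) (truncS k)) =
    limit_inj V k (push (val w) k).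
  elim: k => [|k IH].
    congr (quotmod_proj _ _); apply: val_inj; apply: functional_extensionality_dep => n.
    rewrite /= /trunc /single; case: n => [|n] /=; first by rewrite eqtype.dfwith_in.
    by rewrite eqtype.dfwith_out.
  rewrite [push _ _]/= linearD limit_inj_dmap -IH.
  rewrite limit_injE -linearD; congr (quotmod_proj _ _); apply: val_inj.
  apply: functional_extensionality_dep => n.
  rewrite [RHS](_ : _ = trunc k n + single V (val w k.+1) n) // /= /trunc /single.
  have [->|nk] := eqVneq n k.+1; first by rewrite leqnn ltnn eqtype.dfwith_in add0r.
  by rewrite eqtype.dfwith_out 1?eq_sym // addr0 leq_eqVlt (negbTE nk).
exists K, (push (val w) K); rewrite -truncE -[LHS]quotmod_projK; congr (quotmod_proj _ _).
apply: val_inj; apply: functional_extensionality_dep => n; rewrite /= /trunc.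
by case: leqP => // /ltnW /wK.
Qed.

End DirectLimitElements.

(** * Support and associated primes for a maximal ideal *)

Section MaximalIdeal.
Variables (R : comNzRingType) (m : {pred R}) (M : lmodType R).

Lemma ideal_pow_expr a n : a \in m -> (a ^+ n : R^o) \in ideal_pow m n.
Proof.
move=> am; elim: n => [|n IH]; first exact/mkSubmodP.
by rewrite exprS; apply: submod_span_gen; exists a, (a ^+ n).
Qed.

Lemma pow_mul_scale (b : R) n (x : M) : (b : R^o) \in ideal_pow m n -> b *: x \in pow_mul m M n.
Proof.
by move=> bm; apply: submod_span_gen; exists b, x; split=> //; exact/mkSubmodP.
Qed.

Lemma prime_over_maximal (p : {pred R}) :
  maximal_ideal m -> prime_ideal p -> {subset m <= p} -> p = m :> (R -> bool).
Proof.
by move=> [_ mmax] [pI _] mp; apply: funext; exact: (mmax p pI mp).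
Qed.

(** By maximality [m] is not contained in [p]; the power [a ^+ n] of an element [a] of [m] outside
    [p] is the required [b]. *)
Lemma nmem_powP (p : {pred R}) : maximal_ideal m -> prime_ideal p ->
  p <> m :> (R -> bool) -> forall n, exists2 b : R, (b : R^o) \in ideal_pow m n & b \notin p.
Proof.
move=> mM pP pm n.
have [a am ap] : exists2 a, a \in m & a \notin p.
  apply: contrapT => none; apply: pm; apply: prime_over_maximal => // a am.
  by apply: contrapT => /negP ap; apply: none; exists a.
exists (a ^+ n); first exact: ideal_pow_expr.
elim: n => [|n IH]; first by rewrite expr0 prime1.
by rewrite exprS primeM.
Qed.

Variables (N : lmodType R) (E : injective_resolution N).

(** Already on cochains: a linear map on [M / m^n M] times [b] is evaluation at multiples of [b],
    which are zero. *)
Lemma Ext_quot_torsion i n (b : R) (e : Ext E i (quotmod (pow_mul m M n))) :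
  (b : R^o) \in ideal_pow m n -> b *: e = 0.
Proof.
move=> bm; rewrite -[e]quotmod_projK -linearZ; apply/eqP.
rewrite quotmod_proj_eq0 submod_preimP.
rewrite (_ : submod_incl _ _ = 0) ?rpred0 //.
apply: linear_ext => u.
rewrite [LHS](_ : _ = b *: (val (repr e) : {linear _ -> E i}) u) //.
rewrite -linearZ -[u]quotmod_projK -linearZ.
have /eqP-> : quotmod_proj (pow_mul m M n) (b *: repr u) == 0.
  by rewrite quotmod_proj_eq0 pow_mul_scale.
by rewrite linear0.
Qed.

Lemma Supp_gen_local_cohomology i : maximal_ideal m ->
  (Supp (gen_local_cohomology m M i E) `<=` [set (m : R -> bool)])%classic.
Proof.
move=> mM p [pP [z zn0]]; apply: contrapT => pm; apply: zn0.
rewrite -[z]reprK; case: (repr z) => -[x s] sp /=.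
have [n [e xE]] := limit_inj_surj x.
have [b bm bp] := nmem_powP mM pP pm n.
(* The multiplier [b] lies outside [p] and kills the numerator, so the fraction is zero. *)
apply/eqmodP/asboolP; exists b => //=.
rewrite scaler0 scaler0 scale1r xE -linearZ.
by rewrite Ext_quot_torsion // linear0.
Qed.

Local Notation D := (ideal_transform_functor m M).

Lemma pow_mul_le n k : (n <= k)%N -> {subset pow_mul m M k <= pow_mul m M n}.
Proof.
move=> /subnK <-; elim: (k - n)%N => [|j IH] // x xm.
by apply: IH; exact: pow_mulS.
Qed.

(** The transition maps are restrictions, so pushing to stage [k] restricts to [m^k M]. Equality of
    underlying elements of [M] keeps membership proofs out of the way. *)
Lemma push_restrict (V : lmodType R) n (f : transform_system m M V n) k
    (y : submod (pow_mul m M k)) (y' : submod (pow_mul m M n)) :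
  (n <= k)%N -> val y = val y' ->
  (push (single (transform_system m M V) f) k : {linear _ -> V}) y = (f : {linear _ -> V}) y'.
Proof.
move=> /subnK nk; move: nk y; move: (k - n)%N => j <-.
elim: j => [|j IH] y yE.
  by rewrite push_single_diag (val_inj yE).
rewrite push_singleS ?leq_addl //=.
exact: IH.
Qed.

Lemma ideal_transform_map_inj (U V : lmodType R) (d : {linear U -> V}) n
    (f : transform_system m M U n) :
  ideal_transform_map m M d (limit_inj (transform_system m M U) n f) =
  limit_inj (transform_system m M V) n (postcomp _ d f).
Proof. exact: direct_limit_map_inj. Qed.

(** The differential of a representative vanishes only at some later stage; restricting the
    representative to that stage makes it an honest cocycle. *)
Lemma ideal_transform_cocycle i (z : D (E i)) : fmap D (rdiff E i) z = 0 ->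
  exists n (f : {linear submod (pow_mul m M n) -> E i}),
    z = limit_inj (transform_system m M (E i)) n f /\ forall x, rdiff E i (f x) = 0.
Proof.
have [n [f ->]] := limit_inj_surj z.
rewrite [fmap _ _ _]ideal_transform_map_inj => /limit_inj_eq0[k nk fk].
exists k, (push (single (transform_system m M (E i)) f) k); split.
  by rewrite limit_inj_push.
move=> x; pose y : submod (pow_mul m M n) := exist _ (val x) (pow_mul_le nk (valP x)).
rewrite (@push_restrict _ _ f _ x y) //.
have := @push_restrict _ _ (postcomp _ (rdiff E i) f) _ x y nk erefl.
by rewrite fk => /= <-.
Qed.

(** The canonical map from Hom(M, V) to D_m(M, V). It passes through stage 0, where [m^0 M] is all
    of [M] but a different type. *)
Definition restrict_pow0 (V : lmodType R) : {linear Defs.Hom M V -> D V} :=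
  limit_inj (transform_system m M V) 0 \o precomp V (submod_incl (pow_mul m M 0)).

Lemma restrict_pow0_natural (U V : lmodType R) (d : {linear U -> V}) f :
  restrict_pow0 V (postcomp M d f) = fmap D d (restrict_pow0 U f).
Proof.
rewrite [RHS]ideal_transform_map_inj; congr (limit_inj _ _ _).
exact: linear_ext.
Qed.

(** By naturality; hence Ext^i(M, N) maps to R^i D_m(M, N). *)
Lemma restrict_pow0_coboundary i (f : Defs.Hom M (E i)) : hom_coboundary f ->
  restrict_pow0 (E i) f \in coboundaries (apply_complex E D) i.
Proof.
case: i f => [|i] f; first by move=> ->; rewrite linear0 rpred0.
move=> [g gE]; apply/submod_imP; exists (restrict_pow0 (E i) g).
rewrite [LHS](_ : _ = fmap D (rdiff E i) (restrict_pow0 (E i) g)) // -restrict_pow0_natural.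
by congr (restrict_pow0 _ _); apply: linear_ext => x; exact: gE.
Qed.

(* A cocycle f : m^n M -> E^i extends to g : M -> E^i by injectivity; for b in
   m^n the multiple b g is a cocycle on M, because b M lies in m^n M. *)
Lemma ideal_transform_cocycle_lift i (z : D (E i)) : fmap D (rdiff E i) z = 0 ->
  exists n (g : Defs.Hom M (E i)), forall b : R, (b : R^o) \in ideal_pow m n ->
    hom_cocycle (b *: g) /\ b *: z = restrict_pow0 (E i) (b *: g).
Proof.
move=> /ideal_transform_cocycle[n [f [-> fd]]].
have [g gE] := injective_extend f (@robj_inj _ _ E i).
exists n, g => b bm; split=> [x|].
  have bx := pow_mul_scale x bm.
  rewrite [X in rdiff E i X](_ : _ = g (b *: x)); last by rewrite linearZ.
  by have := gE (exist _ (b *: x) bx) => /= ->; exact: fd.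
rewrite -linearZ.
set h := precomp (E i) (submod_incl (pow_mul m M 0)) (b *: (g : Defs.Hom M (E i))).
(* The two sides live at stages [n] and 0; pushing the second to stage [n] makes them comparable on
   [m^n M]. *)
rewrite -[RHS]/(limit_inj (transform_system m M (E i)) 0 h) -(@limit_inj_push _ _ 0 _ n) //.
congr (limit_inj _ _ _).
apply: linear_ext => x.
pose y : submod (pow_mul m M 0) := exist _ (val x) (pow_mul_le (leq0n n) (valP x)).
rewrite (@push_restrict _ _ _ _ x y) //.
by rewrite [RHS](_ : _ = b *: g (val x)) // gE.
Qed.

(** The [colon_primes] term is the set of associated primes of the image of Ext^i(M, N) in R^i
    D_m(M, N), expressed inside Hom(M, E^i). *)
Lemma Ass_derived_ideal_transform i : maximal_ideal m ->
  (Ass (derived_ideal_transform m M i E) `<=`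
   [set (m : R -> bool)] `|`
   colon_primes
     (submod_preim (restrict_pow0 (E i)) (coboundaries (apply_complex E D) i))
     (@hom_cocycle _ _ E i M))%classic.
Proof.
move=> mM p [pP [q qE]].
have [|pm] := pselect (p = m :> (R -> bool)); first by left.
right; split=> //; pose z := val (repr q).
have /ideal_transform_cocycle_lift[n [g gE]] : fmap D (rdiff E i) z = 0.
  exact: (submod_kerP (cdiff (apply_complex E D) i) _ (valP (repr q))).
have [b bm bp] := nmem_powP mM pP pm n; have [bgZ bz] := gE b bm.
exists (b *: g) => // a.
(* Since [b] is outside [p], [a] lies in [p] exactly when [a * b] kills [q], that is, when [a] kills
   [b *: q]. *)
rewrite -[p a]/(a \in (p : {pred R})) -(prime_nmemM a pP bp) -[LHS]/(p (a * b)) qE.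
rewrite submod_preimP linearZ -bz -[q]quotmod_projK -linearZ quotmod_proj_eq0 submod_preimP.
by rewrite -scalerA.
Qed.

End MaximalIdeal.

Theorem theorem3p3 (R : comNzRingType) (M N : lmodType R) (m : {pred R}) :
  noetherian_ring R ->
  finitely_generated M ->
  weakly_laskerian N ->
  maximal_ideal m ->
  forall (E : injective_resolution N) (i : nat),
    finite_set (Supp (gen_local_cohomology m M i E)) /\
    finite_set (Ass (derived_ideal_transform m M i E)).
Proof.
move=> noeR fgM wN mM E i; split.
  by apply: sub_finite_set (finite_set1 _); exact: Supp_gen_local_cohomology.
apply: sub_finite_set (Ass_derived_ideal_transform mM) _; rewrite finite_setU; split.
  exact: finite_set1.
(* What remains is that the submodule defining the colon ideals contains the coboundaries. *)
apply: (laskerian_hom_cohomology noeR wN fgM) => f fB.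
by rewrite submod_preimP; exact: restrict_pow0_coboundary.
Qed.
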